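(* For every integer $n\ge 0$, $$\sum_{k=0}^{n}(-1)^{n-k}\det\begin{pmatrix} M_{n,k}(0,0) & M_{n,k+1}(0,0)\\ M_{n+1,k}(0,0) & M_{n+1,k+1}(0,0)\end{pmatrix}=C_{n+1};$$ or equivalently (the cases $n=2m$ and $n=2m+1$ respectively), for every integer $m\ge 0$, $$C_{2m+1}=\sum_{j=0}^{m}\frac{(2j+2)^2}{(2m+2)^2}\binom{2m+2}{m-j}^2,$$ $$C_{2m+2}=\sum_{j=0}^{m}\frac{(2j+2)^2}{(2m+2)(2m+3)}\binom{2m+3}{m-j}\binom{2m+3}{m-j+1}.$$
   Context: $C_n=\frac{1}{n+1}\binom{2n}{n}$ is the $n$-th Catalan number. A partial Motzkin path from $(0,0)$ to $(n,k)$ is a lattice path that never goes below the $X$-axis and consists of up steps $U=(1,1)$, down steps $D=(1,-1)$ and horizontal steps $H=(1,0)$. Every up step and every down step has weight $1$, every horizontal step lying on the $X$-axis has weight $x$, and every horizontal step not lying on the $X$-axis has weight $y$; the weight of a path is the product of the weights of its steps. $M_{n,k}(x,y)$ is the sum of the weights of all partial Motzkin paths from $(0,0)$ to $(n,k)$. Equivalently, $M_{0,0}(x,y)=1$, $M_{n,k}(x,y)=0$ if $n<k$ or $k<0$, $M_{n,0}(x,y)=xM_{n-1,0}(x,y)+M_{n-1,1}(x,y)$ for $n\ge1$, and $M_{n,k}(x,y)=M_{n-1,k-1}(x,y)+yM_{n-1,k}(x,y)+M_{n-1,k+1}(x,y)$ for $n\ge k\ge 1$. $M_{n,k}(0,0)$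 is the value at $x=y=0$. *)

(* Defs.v *)
From HB Require Import structures.
From mathcomp Require Import all_boot all_order all_algebra.
Set Implicit Arguments.
Unset Strict Implicit.
Unset Printing Implicit Defensive.
Import Order.TTheory GRing.Theory Num.Theory.
Local Open Scope ring_scope.

Inductive step : Type := Up | Down | Hor.

Definition step_code (s : step) : option bool :=
  match s with Up => Some true | Down => Some false | Hor => None end.

Definition step_decode (c : option bool) : step :=
  match c with Some true => Up | Some false => Down | None => Hor end.

Lemma step_codeK : cancel step_code step_decode.
Proof. by case. Qed.

HB.instance Definition _ := Finite.copy step (can_type step_codeK).

Definition rise (s : step) : int :=
  match s with Up => 1 | Down => -1 | Hor => 0 end.

(* Ordinate reached after the steps of p, starting from the origin; the
   abscissa reached is size p. *)
Definition height (p : seq step) : int := \sum_(s <- p) rise s.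

Definition motzkin_path (n : nat) (k : int) (p : n.-tuple step) : bool :=
  [forall i : 'I_n.+1, 0 <= height (take i p)] && (height p == k).

(* h is the ordinate of the point from which the step s starts. *)
Definition step_weight (R : comNzRingType) (x y : R) (h : int) (s : step) : R :=
  match s with
  | Hor => if h == 0 then x else y
  | _ => 1
  end.

Definition path_weight (R : comNzRingType) (x y : R) (n : nat)
    (p : n.-tuple step) : R :=
  \prod_(i < n) step_weight x y (height (take i p)) (tnth p i).

Definition motzkin (R : comNzRingType) (n : nat) (k : int) (x y : R) : R :=
  \sum_(p : n.-tuple step | motzkin_path k p) path_weight x y p.

Definition catalan (n : nat) : rat := (n.+1)%:R^-1 * 'C(2 * n, n)%:R.

(* Main.v *)
(* At x = y = 0 the Motzkin sums are the ballot numbers b(n, k), which vanish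
   unless n and k have the same parity.  Hence each signed determinant equals
   b(n, k) b(n+1, k+1) + b(n, k+1) b(n+1, k), and the recurrence of b turns the
   sum of these into \sum_k b(n, k) b(n+2, k).  Cutting a ballot path of length
   2n+2 at abscissa n shows that this is b(2n+2, 0) = C_(n+1).  With the closed
   form (n+1) b(n, k) = (k+1) 'C(n+1, (n-k)/2), cutting paths of length 4m+2 in
   two halves, and paths of length 4m+4 at abscissa 2m+1, gives the two
   explicit sums. *)
Require Import Defs.
From HB Require Import structures.
From mathcomp Require Import all_boot all_order all_algebra.
From mathcomp Require Import zify ring.

Set Implicit Arguments.
Unset Strict Implicit.
Unset Printing Implicit Defensive.
Import Order.TTheory GRing.Theory Num.Theory.
Local Open Scope ring_scope.

(** * Recurrence of the Motzkin sums by removal of the last step *)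

Lemma height_rcons (p : seq step) (s : step) :
  height (rcons p s) = height p + rise s.
Proof. by rewrite /height -cats1 big_cat big_seq1. Qed.

Lemma motzkin_path_rcons (n : nat) (k : int) (p : n.-tuple step) (s : step) :
  motzkin_path k [tuple of rcons p s]
  = (0 <= k) && motzkin_path (k - rise s) p.
Proof.
rewrite /motzkin_path /= height_rcons -(can2_eq (addrK _) (subrK _)).
have [<-|] := eqVneq; last by rewrite !andbF.
rewrite !andbT; apply/forallP/andP => [H | [H /forallP Hp] i].
  split.
    by have := H ord_max; rewrite take_oversize ?height_rcons // size_rcons size_tuple.
  apply/forallP => i; have := H (widen_ord (leqnSn _) i).
  by rewrite -cats1 takel_cat // size_tuple; exact: (leq_ord i).
have [lt_in | le_ni] := ltnP i n.+1.
  by have := Hp (Ordinal lt_in); rewrite -cats1 takel_cat // size_tuple -ltnS.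
by rewrite take_oversize ?height_rcons // size_rcons size_tuple.
Qed.

Lemma path_weight_rcons (R : comNzRingType) (x y : R) (n : nat)
    (p : n.-tuple step) (s : step) :
  path_weight x y [tuple of rcons p s]
  = path_weight x y p * step_weight x y (height p) s.
Proof.
rewrite /path_weight big_ord_recr /=; congr (_ * _).
  apply: eq_bigr => i _; rewrite !(tnth_nth Up) /= nth_rcons size_tuple ltn_ord.
  by rewrite -cats1 takel_cat // size_tuple ltnW.
rewrite (tnth_nth Up) /= nth_rcons size_tuple ltnn eqxx.
by rewrite -cats1 take_size_cat ?size_tuple.
Qed.

(** Tuples are cut at the last entry, not the first, because the weight of a step depends on the
    height of the prefix before it. *)
Lemma big_tuple_rcons (R : Type) (idx : R) (op : Monoid.com_law idx)
    (T : finType) (n : nat) (P : pred (n.+1.-tuple T)) (F : n.+1.-tuple T -> R) :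
  \big[op/idx]_(t | P t) F t
  = \big[op/idx]_(s : T)
      \big[op/idx]_(p : n.-tuple T | P [tuple of rcons p s])
        F [tuple of rcons p s].
Proof.
pose h (u : T * n.-tuple T) := [tuple of rcons u.2 u.1].
rewrite (reindex h) /=.
  by rewrite (pair_big_dep xpredT (fun s (p : n.-tuple T) => P [tuple of rcons p s])
               (fun s (p : n.-tuple T) => F [tuple of rcons p s])).
apply: onW_bij; apply: inj_card_bij => [[s p] [s' p'] /(congr1 val)/= /rcons_inj|].
  by case=> /val_inj-> ->.
by rewrite card_prod !card_tuple expnS.
Qed.

Lemma motzkin0 (R : comNzRingType) (k : int) (x y : R) :
  motzkin 0 k x y = (k == 0)%:R.
Proof.
rewrite /motzkin (eq_bigl (fun p => (p == [tuple]) && (k == 0))) => [|p].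
  case: (k == 0).
    by rewrite (eq_bigl (pred1 [tuple])) => [|p]; rewrite ?andbT // big_pred1_eq /path_weight big_ord0.
  by rewrite big_pred0 // => p; rewrite andbF.
have height_nil : height [::] = 0 by rewrite /height big_nil.
have -> : p = [tuple] := tuple0 p.
have all_ge0 : [forall i : 'I_1, 0 <= height (take i [tuple])].
  by apply/forallP => i; rewrite height_nil.
by rewrite /motzkin_path all_ge0 eqxx -[height _]/(height [::]) height_nil eq_sym.
Qed.

Lemma motzkin_neg (R : comNzRingType) (n : nat) (k : int) (x y : R) :
  k < 0 -> motzkin n k x y = 0.
Proof.
move=> k_lt0; rewrite /motzkin big_pred0 // => p; apply/negbTE/negP => /andP[].
move=> /forallP/(_ ord_max); rewrite take_oversize ?size_tuple //.
by move=> ge0_h /eqP def_k; rewrite leNgt def_k k_lt0 in ge0_h.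
Qed.

(** Without its last step [s], the path ends at [k - rise s], and this ordinate also fixes the
    weight of [s]. For [k = 0] the term at [k - 1] is zero by [motzkin_neg]. *)
Lemma motzkinS (R : comNzRingType) (n : nat) (k : int) (x y : R) :
  0 <= k ->
  motzkin n.+1 k x y
  = motzkin n (k - 1) x y + (if k == 0 then x else y) * motzkin n k x y
    + motzkin n (k + 1) x y.
Proof.
move=> k_ge0; rewrite /motzkin big_tuple_rcons.
pose G s := \sum_(p : n.-tuple step | motzkin_path (k - rise s) p)
    path_weight x y p * step_weight x y (k - rise s) s.
rewrite (eq_bigr G) => [|s _]; last first.
  apply: eq_big => [p | p]; rewrite motzkin_path_rcons k_ge0 //=.
  by case/andP=> _ /eqP <-; rewrite path_weight_rcons.
have -> : \sum_s G s = \sum_(s <- [:: Up; Hor; Down]) G s.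
  rewrite -big_enum; apply: perm_big; apply: uniq_perm; rewrite ?enum_uniq //.
  by move=> s; rewrite mem_enum; case: s.
rewrite !big_cons big_nil addr0 addrA /G /= opprK subr0; congr (_ + _ + _).
- by apply: eq_bigr => p _; rewrite mulr1.
- by rewrite -mulr_suml mulrC.
- by apply: eq_bigr => p _; rewrite mulr1.
Qed.

(** * Ballot numbers and their closed form *)

Fixpoint ballot (n k : nat) : nat :=
  match n, k with
  | 0, _ => k == 0
  | n'.+1, 0 => ballot n' 1
  | n'.+1, k'.+1 => ballot n' k' + ballot n' k'.+2
  end.

Lemma motzkin00 (R : comNzRingType) (n k : nat) :
  motzkin n k (0 : R) 0 = (ballot n k)%:R.
Proof.
elim: n k => [|n IHn] k; first by rewrite motzkin0.
rewrite motzkinS // if_same mul0r addr0.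
case: k => [|k]; first by rewrite motzkin_neg // !add0r (IHn 1).
by rewrite /= natrD -!IHn; congr (motzkin _ _ _ _ + motzkin _ _ _ _); lia.
Qed.

Lemma ballot_gt (n k : nat) : (n < k)%N -> ballot n k = 0%N.
Proof.
by elim: n k => [|n IHn] [|k] //= lt_nk; rewrite !IHn // ltnW // ltnW.
Qed.

Lemma ballot_odd (n k : nat) : odd (n + k) -> ballot n k = 0%N.
Proof.
elim: n k => [|n IHn] [|k] //=; rewrite ?addn0 => odd_nk.
  by rewrite IHn // addn1.
by rewrite !IHn //; move: odd_nk; rewrite !addnS /= ?negbK.
Qed.

(** Induction on the length, with [i] the number of down steps. Absorption identities express the
    binomials of the previous row through a single one of the new row. *)
Lemma mul_ballot_bin (n k i : nat) :
  n = (k + i.*2)%N -> (n.+1 * ballot n k = k.+1 * 'C(n.+1, i))%N.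
Proof.
elim: n k i => [|n IHn] [|k] [|i] // def_n; try by lia.
- have := IHn 1%N i ltac:(lia); have := mul_bin_diag n.+2 i.
  rewrite /=; set b := ballot _ _; set B := 'C(n.+1, i); set D := 'C(n.+2, i.+1).
  have -> : n = i.*2.+1 by lia.
  move=> e1 e2; apply/eqP; rewrite -(eqn_pmul2l (ltn0Sn i)); apply/eqP; nia.
- have -> : k = n by lia.
  have := IHn n 0%N ltac:(lia).
  by rewrite /= (@ballot_gt n n.+2) // !bin0; nia.
- have := IHn k i.+1 ltac:(lia); have := IHn k.+2 i ltac:(lia).
  have := mul_bin_diag n.+2 i; have := mul_bin_down n.+2 i.+1.
  have -> : (n.+2 - i.+1 = k + i + 3)%N by lia.
  rewrite /=; set u := ballot _ _; set v := ballot _ _.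
  set A := 'C(n.+1, i.+1); set B := 'C(n.+1, i); set D := 'C(n.+2, i.+1).
  have -> : n = (k + i + i + 2)%N by lia.
  move=> e1 e2 h1 h2; apply/eqP.
  (* The factor is [n.+1], which lets the induction hypotheses replace [u] and [v]. *)
  rewrite -(eqn_pmul2l (ltn0Sn (k + i + i + 2))); apply/eqP.
  nia.
Qed.

Lemma catalan_ballot (n : nat) : catalan n = (ballot n.*2 0)%:R.
Proof.
have := @mul_ballot_bin n.*2 0 n erefl; have := mul_bin_down n.*2.+1 n.
rewrite /catalan mul2n mul1n.
have -> : (n.*2.+1 - n = n.+1)%N by lia.
move=> e1 e2; have : (n.+1 * ballot n.*2 0 = 'C(n.*2, n))%N.
  by apply/eqP; rewrite -(eqn_pmul2l (ltn0Sn n.*2)) mulnCA e2 -e1.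
by move <-; rewrite natrM mulKf // pnatr_eq0.
Qed.

(** * Convolution of ballot numbers and the determinant sum *)

(** Summation by parts: the right side is symmetric in [a] and [c], so two uses move a step from one
    factor to the other. The hypothesis kills the only boundary term, at [k = N]. *)
Lemma ballot_sumS (a c N : nat) :
  (ballot a N * ballot c N.+1 = 0)%N ->
  (\sum_(k < N.+1) ballot a.+1 k * ballot c k
   = \sum_(k < N.+1) (ballot a k * ballot c k.+1 + ballot a k.+1 * ballot c k))%N.
Proof.
move=> top0; rewrite big_split /= [in RHS]big_ord_recr /= top0 addn0.
rewrite [LHS]big_ord_recl [X in (_ = _ + X)%N]big_ord_recl /= addnCA; congr (_ + _)%N.
by rewrite -big_split; apply: eq_bigr => i _; rewrite /= mulnDl.
Qed.

(* Splitting a ballot path of length [a + c] at abscissa [a]. *)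
Lemma ballot_convolution (a c N : nat) :
  (a <= N)%N ->
  (\sum_(k < N.+1) ballot a k * ballot c k = ballot (a + c) 0)%N.
Proof.
elim: a c => [|a IHa] c le_aN.
  by rewrite big_ord_recl mul1n big1 ?addn0.
rewrite ballot_sumS ?(@ballot_gt a N) // addSnnS -IHa 1?ltnW //.
under [RHS]eq_bigr do rewrite mulnC.
rewrite ballot_sumS ?(@ballot_gt a N.+1) ?muln0 1?ltnW //.
by apply: eq_bigr => k _; rewrite addnC [X in (X + _)%N]mulnC [X in (_ + X)%N]mulnC.
Qed.

(* By parity at most one of the two products in each determinant is nonzero,
   and the sign [(-1) ^+ (n - k)] is exactly the one making it positive. *)
Lemma motzkin_det (R : comNzRingType) (n k : nat) :
  (k <= n)%N ->
  (-1) ^+ (n - k)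
    * \det (\matrix_(i < 2, j < 2) motzkin (n + i) (k + j)%N (0 : R) 0)
  = (ballot n k * ballot n.+1 k.+1 + ballot n k.+1 * ballot n.+1 k)%N%:R.
Proof.
move=> le_kn; rewrite (expand_det_row _ 0) !big_ord_recl big_ord0 addr0.
rewrite /cofactor !det_mx11 /= expr0 expr1 mul1r mulN1r mulrN !mxE /= !addn0 !addn1 !motzkin00.
rewrite -signr_odd oddB //; have [odd_nk | even_nk] := boolP (odd n (+) odd k).
  rewrite (@ballot_odd n k) ?oddD // mul0r mul0n sub0r add0n expr1.
  by rewrite mulN1r opprK natrM.
rewrite (@ballot_odd n k.+1) ?addnS /= ?oddD // mul0r mul0n subr0 addn0.
by rewrite expr0 mul1r natrM.
Qed.

Lemma motzkin_det_sum (n : nat) :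
  \sum_(0 <= k < n.+1)
    (-1) ^+ (n - k)
    * \det (\matrix_(i < 2, j < 2) motzkin (n + i) (k + j)%N (0 : rat) 0)
  = catalan n.+1.
Proof.
rewrite big_mkord; under eq_bigr => k _ do rewrite motzkin_det -1?ltnS //.
rewrite -natr_sum catalan_ballot; congr (_ %:R).
(* Cutting at [n] instead of the middle: undoing one step of the longer factor leaves lengths [n]
   and [n.+1], the two rows of the determinant. *)
have -> : n.+1.*2 = (n + n.+2)%N by lia.
rewrite -(ballot_convolution n.+2 (leqnn n)).
under [RHS]eq_bigr do rewrite mulnC.
rewrite ballot_sumS ?(@ballot_gt n n.+1) ?muln0 //.
by apply: eq_bigr => k _; rewrite addnC [X in (X + _)%N]mulnC [X in (_ + X)%N]mulnC.
Qed.

(** * The two explicit sums *)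

Lemma sum_ballot_odd (m : nat) (F : nat -> nat) :
  (\sum_(k < m.*2.+2) ballot m.*2.+1 k * F k
   = \sum_(j < m.+1) ballot m.*2.+1 j.*2.+1 * F j.*2.+1)%N.
Proof.
have split (G : nat -> nat) n :
    (\sum_(k < n.*2) G k = \sum_(j < n) (G j.*2 + G j.*2.+1))%N.
  elim: n => [|n IHn]; first by rewrite !big_ord0.
  by rewrite doubleS !big_ord_recr /= IHn addnA.
rewrite -doubleS (split (fun k => ballot m.*2.+1 k * F k)%N).
apply: eq_bigr => j _.
by rewrite (@ballot_odd m.*2.+1 j.*2) // addSn /= -doubleD odd_double.
Qed.

Lemma ballot_bin (R : numFieldType) (k i n : nat) :
  n = (k + i.*2)%N ->
  (ballot n k)%:R = k.+1%:R / n.+1%:R * 'C(n.+1, i)%:R :> R.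
Proof.
move=> def_n; rewrite mulrAC -natrM -(mul_ballot_bin def_n) natrM mulrAC divff ?mul1r //.
by rewrite pnatr_eq0.
Qed.

Lemma catalan_odd (m : nat) :
  catalan (2 * m + 1)
  = \sum_(0 <= j < m.+1)
       ((2 * j + 2)%N%:R ^+ 2 / (2 * m + 2)%N%:R ^+ 2)
       * 'C(2 * m + 2, m - j)%:R ^+ 2.
Proof.
have -> : (2 * m + 1 = m.*2.+1)%N by lia.
have -> : (2 * m + 2 = m.*2.+2)%N by lia.
rewrite catalan_ballot -addnn -(ballot_convolution _ (leqnn _)).
rewrite sum_ballot_odd natr_sum big_mkord; apply: eq_bigr => j _.
have lt_jm := ltn_ord j.
(* A path of length [2m+1] ending at height [2j+1] has [m - j] down steps. *)
rewrite natrM (@ballot_bin _ _ (m - j)); last by lia.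
have -> : (2 * j + 2 = j.*2.+2)%N by lia.
by rewrite -expr2 exprMn expr_div_n.
Qed.

Lemma catalan_even (m : nat) :
  catalan (2 * m + 2)
  = \sum_(0 <= j < m.+1)
       ((2 * j + 2)%N%:R ^+ 2 / ((2 * m + 2)%N%:R * (2 * m + 3)%N%:R))
       * 'C(2 * m + 3, m - j)%:R * 'C(2 * m + 3, m - j + 1)%:R.
Proof.
rewrite catalan_ballot.
have -> : ((2 * m + 2).*2 = m.*2.+1 + m.*2.+3)%N by lia.
rewrite -(ballot_convolution _ (leqnn _)).
rewrite (sum_ballot_odd m (ballot m.*2.+3)) natr_sum big_mkord.
apply: eq_bigr => j _; have lt_jm := ltn_ord j.
rewrite natrM (@ballot_bin _ _ (m - j)); last by lia.
rewrite (@ballot_bin _ _ (m - j + 1)); last by lia.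
have -> : (2 * j + 2 = j.*2.+2)%N by lia.
have -> : (2 * m + 2 = m.*2.+2)%N by lia.
have -> : (2 * m + 3 = m.*2.+3)%N by lia.
(* The closed form yields binomials of rows [2m+2] and [2m+4]. Both are moved to row [2m+3]; the
   factor [m + j + 3] enters once as numerator and once as denominator, hence cancels. *)
have := mul_bin_down m.*2.+3 (m - j); have := mul_bin_down m.*2.+4 (m - j + 1).
have -> : (m.*2.+4 - (m - j + 1) = m + j + 3)%N by lia.
have -> : (m.*2.+3 - (m - j) = m + j + 3)%N by lia.
move=> /= /(congr1 (fun n => n%:R : rat)) e1 /(congr1 (fun n => n%:R : rat)) e2.
move: e1 e2; rewrite !natrM.
set a : rat := m.*2.+2%:R; set b : rat := m.*2.+3%:R; set c : rat := m.*2.+4%:R.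
set t : rat := (m + j + 3)%:R; set w : rat := j.*2.+2%:R.
have [a0 b0 c0] : [/\ a != 0, b != 0 & c != 0] by rewrite !pnatr_eq0.
have t0 : t != 0 by rewrite pnatr_eq0 addnS.
move=> e1 e2.
rewrite -[X in _ / c * X](mulKf t0) -e1.
rewrite -[X in _ / a * X](mulKf b0) e2.
by clearbody a b c t w; field; rewrite a0 b0 c0 t0.
Qed.

Theorem theorem4p1 :
  (forall n : nat,
     \sum_(0 <= k < n.+1)
        (-1) ^+ (n - k)
        * \det (\matrix_(i < 2, j < 2) motzkin (n + i) (k + j)%N (0 : rat) 0)
     = catalan n.+1)
  /\ (forall m : nat,
        catalan (2 * m + 1)
        = \sum_(0 <= j < m.+1)
             ((2 * j + 2)%N%:R ^+ 2 / (2 * m + 2)%N%:R ^+ 2)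
             * 'C(2 * m + 2, m - j)%:R ^+ 2)
  /\ (forall m : nat,
        catalan (2 * m + 2)
        = \sum_(0 <= j < m.+1)
             ((2 * j + 2)%N%:R ^+ 2 / ((2 * m + 2)%N%:R * (2 * m + 3)%N%:R))
             * 'C(2 * m + 3, m - j)%:R * 'C(2 * m + 3, m - j + 1)%:R).
Proof.
by split; [exact: motzkin_det_sum | split; [exact: catalan_odd | exact: catalan_even]].
Qed.
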